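(* Let $B$ be a finite abelian group and let $G$ be a self-similar group of orbit-type $(m_1,\dots,m_s)$ with $m_1\ge2,\dots,m_s\ge2$, with respect to the data $(\mathbf{m},\mathbf{H},\mathbf{F})$, where $\mathbf{m}=(m_1,\dots,m_s)$, $\mathbf{H}=\{H_1,\dots,H_s\}$, $\mathbf{F}=\{f_1,\dots,f_s\}$. Let $G_{\omega_1},\dots,G_{\omega_s}$ be the associated parabolic subgroups. Then the group $$B^{((G_{\omega_1}\setminus G)\times\dots\times(G_{\omega_s}\setminus G))}\rtimes G^s$$ is self-similar of orbit-type $(|B|\cdot m_1\cdots m_s,\ 1)$.
   Context: For a finite set $Y$ of size $m$, $\mathcal{A}(Y)$ is the automorphism group of the rooted $m$-tree of finite strings over $Y$; each $\alpha\in\mathcal{A}(Y)$ has states $\alpha_y\in\mathcal{A}(Y)$ ($y\in Y$) given by $(yu)^\alpha=y^{\alpha}u^{\alpha_y}$. A subgroup is state-closed if it contains all states of its elements. A group is self-similar of orbit-type $(m_1,\dots,m_s)$ if it is isomorphic to a state-closed subgroup of $\mathcal{A}(Y)$, $|Y|=m_1+\dots+m_s$, having exactly $s$ orbits on $Y$, of sizes $m_1,\dots,m_s$ (transitivity is not required). Data: a $G$-data $(\mathbf{m},\mathbf{H},\mathbf{F})$ consists of subgroups $H_i\le G$ with $[G:H_i]=m_i$ and homomorphisms $f_i:H_i\to G$ ($1\le i\le s$). A state-closed group $G\le\mathcal{A}(Y)$ with orbits $Y_1,\dots,Y_s$ of sizes $m_i$ and chosen $y_{i1}\in Y_i$ yields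 the data $H_i=\mathrm{Fix}_G(y_{i1})$, $f_i:H_i\to G$, $g\mapsto g_{y_{i1}}$. Conversely, a data gives a state-closed representation of $G$ of orbit-type $\mathbf{m}$ (by the state-closed recursion using right transversals of the $H_i$), and it is faithful exactly when the $\mathbf{F}$-core of $\mathbf{H}$, i.e. the largest subgroup $K\le\bigcap_iH_i$ with $K\trianglelefteq G$ and $K^{f_i}\le K$ for all $i$, is trivial. ''$G$ is self-similar with respect to the data $(\mathbf{m},\mathbf{H},\mathbf{F})$'' means that this representation is faithful. Parabolic subgroups: for each $i$, $G_{i0}=G$, $G_{ij}=(G_{i(j-1)})^{f_i^{-1}}=\{h\in H_i\mid h^{f_i}\in G_{i(j-1)}\}$ for $j>0$, and $G_{\omega_i}=\bigcap_{j\ge0}G_{ij}$. $G_{\omega_i}\setminus G$ is the set of right cosets of $G_{\omega_i}$ in $G$. For a set $U$, $B^{(U)}$ is the group of finitely supported functions $U\to B$. $G^s$ acts on $(G_{\omega_1}\setminus G)\times\dots\times(G_{\omega_s}\setminus G)$ by right translation coordinatewise, and hence on the group of finitely supported functions on this set by translation; this defines the semidirect product. *)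

(* Defs.v *)
(* Groups may be infinite: they are [groupType]s, and their subgroups and cosets
   are classical sets.  Maps act on the right: x^(a b) = (x^a)^b. *)
From HB Require Import structures.
From mathcomp Require Import all_boot all_order all_fingroup.
From mathcomp Require Import boolp classical_sets cardinality.

Set Implicit Arguments.
Unset Strict Implicit.
Unset Printing Implicit Defensive.

Local Open Scope classical_set_scope.
Local Open Scope group_scope.

Definition subgroup (G : groupType) (H : set G) : Prop :=
  H 1 /\ forall x y : G, H x -> H y -> H (x * y^-1).

Definition rcoset_of (G : groupType) (H : set G) (g : G) : set G :=
  [set h * g | h in H].

Definition rcosets_of (G : groupType) (H : set G) : set (set G) :=
  range (rcoset_of H).

Section TreeAutomorphisms.
Variable Y : finType.

Definition tree_edge (u v : seq Y) : Prop :=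
  (exists y, v = rcons u y) \/ (exists y, u = rcons v y).

Record tree_aut := TreeAut {
  ta_fun :> seq Y -> seq Y;
  ta_bij : bijective ta_fun;
  ta_root : ta_fun [::] = [::];
  ta_edge : forall u v, tree_edge (ta_fun u) (ta_fun v) <-> tree_edge u v
}.

Lemma tree_autP (a b : tree_aut) : a =1 b -> a = b.
Proof.
case: a b => [f p1 p2 p3] [g q1 q2 q3] /= /funext efg.
by case: _ / efg q1 q2 q3 => *; congr TreeAut; exact: Prop_irrelevance.
Qed.

HB.instance Definition _ := gen_eqMixin tree_aut.
HB.instance Definition _ := gen_choiceMixin tree_aut.

Definition tree_one : tree_aut.
Proof. by exists id => //; exists id. Defined.

Definition tree_mul (a b : tree_aut) : tree_aut.
Proof.
exists (b \o a); first exact: bij_comp (ta_bij b) (ta_bij a).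
- by rewrite /= !ta_root.
- by move=> u v; rewrite /= !ta_edge.
Defined.

Lemma ta_inv_ex (a : tree_aut) : exists b : tree_aut, cancel a b /\ cancel b a.
Proof.
have [g fg gf] := ta_bij a.
have g0 : g [::] = [::] by rewrite -[in LHS](ta_root a) fg.
have ge u v : tree_edge (g u) (g v) <-> tree_edge u v.
  by rewrite -(ta_edge a) !gf.
by exists (TreeAut (Bijective gf fg) g0 ge).
Qed.

Definition tree_inv (a : tree_aut) : tree_aut := projT1 (cid (ta_inv_ex a)).

Lemma tree_invK (a : tree_aut) : cancel a (tree_inv a) /\ cancel (tree_inv a) a.
Proof. exact: projT2 (cid (ta_inv_ex a)). Qed.

Fact tree_mulA : associative tree_mul.
Proof. by move=> a b c; apply: tree_autP. Qed.
Fact tree_mul1g : left_id tree_one tree_mul.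
Proof. by move=> a; apply: tree_autP. Qed.
Fact tree_mulg1 : right_id tree_one tree_mul.
Proof. by move=> a; apply: tree_autP. Qed.
Fact tree_mulVg : left_inverse tree_one tree_inv tree_mul.
Proof. by move=> a; apply: tree_autP => u /=; rewrite (tree_invK a).2. Qed.
Fact tree_mulgV : right_inverse tree_one tree_inv tree_mul.
Proof. by move=> a; apply: tree_autP => u /=; rewrite (tree_invK a).1. Qed.

HB.instance Definition _ := isGroup.Build tree_aut
  tree_mulA tree_mul1g tree_mulg1 tree_mulVg tree_mulgV.

Lemma ta_rcons (a : tree_aut) u y : exists z, a (rcons u y) = rcons (a u) z.
Proof.
have e v x : tree_edge (a v) (a (rcons v x)) by apply/ta_edge; left; exists x.
elim/last_ind: u y => [|u x IHu] y.
  by have [//|[z]] := e [::] y; rewrite ta_root; case: (a _).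
have [//|[z]] := e (rcons u x) y.
have [x' ->] := IHu x => /rcons_inj[/(bij_inj (ta_bij a)) E _].
have := congr1 size E; rewrite !size_rcons => /esym/eqP.
by rewrite -addn2 -{2}[size u]addn0 eqn_add2l.
Qed.

Lemma ta_size (a : tree_aut) u : size (a u) = size u.
Proof.
elim/last_ind: u => [|u y IHu]; first by rewrite ta_root.
by have [z ->] := ta_rcons a u y; rewrite !size_rcons IHu.
Qed.

(* y^a; the default value of [head] is never used *)
Definition letter (a : tree_aut) (y : Y) : Y := head y (a [:: y]).

Lemma ta_cons (a : tree_aut) y u : a (y :: u) = letter a y :: behead (a (y :: u)).
Proof.
elim/last_ind: u => [|u x IHu].
  by rewrite /letter; have := ta_size a [:: y]; case: (a _).
by rewrite -rcons_cons; have [z ->] := ta_rcons a (y :: u) x; rewrite IHu.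
Qed.

Lemma tree_edge_cons y u v : tree_edge (y :: u) (y :: v) <-> tree_edge u v.
Proof.
split=> -[[x E]|[x E]].
- by left; exists x; case: E.
- by right; exists x; case: E.
- by left; exists x; rewrite E.
- by right; exists x; rewrite E.
Qed.

(* the state a_y, characterised by (y u)^a = y^a u^(a_y) *)
Definition state (a : tree_aut) (y : Y) : tree_aut.
Proof.
exists (fun u => behead (a (y :: u))).
- have [ai ia] := tree_invK a.
  have lK : letter (tree_inv a) (letter a y) = y.
    by have := ai [:: y]; rewrite ta_cons ta_cons => -[].
  exists (fun v => behead (tree_inv a (letter a y :: v))) => u /=.
    by rewrite -ta_cons ai.
  have -> : y :: behead (tree_inv a (letter a y :: u)) =
            tree_inv a (letter a y :: u) by rewrite [RHS]ta_cons lK.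
  by rewrite ia.
- by have := ta_size a [:: y]; case: (a _) => [|z []].
- move=> u v; rewrite -(tree_edge_cons (letter a y)) -!ta_cons ta_edge.
  exact: tree_edge_cons.
Defined.

Lemma stateE (a : tree_aut) y u : a (y :: u) = letter a y :: state a y u.
Proof. exact: ta_cons. Qed.

Definition state_closed (S : set tree_aut) : Prop :=
  forall a y, S a -> S (state a y).

Definition letter_orbit (S : set tree_aut) (y : Y) : {set Y} :=
  [set z | `[< exists2 a, S a & letter a y = z >]]%SET.

Definition letter_orbits (S : set tree_aut) : {set {set Y}} :=
  [set letter_orbit S y | y : Y]%SET.

End TreeAutomorphisms.

(* [perm_eq]: the orbits can be numbered so that their sizes are m_1, ..., m_s *)
Definition self_similar_of_orbit_type (G : groupType) (m : seq nat) : Prop :=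
  exists (Y : finType) (S : set (tree_aut Y)),
    [/\ #|Y| = sumn m, subgroup S, state_closed S,
        perm_eq [seq #|o| | o : {set Y} in letter_orbits S] m
      & exists2 phi : {multiplicative G -> tree_aut Y},
          injective phi & range phi = S].

(* The homomorphism f_i : H_i -> G is encoded by a function on all of G whose
   values outside H_i are irrelevant: every use below is guarded by H_i. *)
Record Gdata (G : groupType) (s : nat) (m : 'I_s -> nat) := GData {
  gd_H : 'I_s -> set G;
  gd_f : 'I_s -> G -> G;
  gd_subgroup : forall i, subgroup (gd_H i);
  gd_index : forall i, (rcosets_of (gd_H i) #= `I_(m i))%card;
  gd_morph : forall i x y, gd_H i x -> gd_H i y ->
    gd_f i (x * y) = gd_f i x * gd_f i y
}.

Section Data.
Variables (G : groupType) (s : nat) (m : 'I_s -> nat) (D : Gdata G m).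

Local Notation H := (gd_H D).
Local Notation f := (gd_f D).

(* {t i j | j < m i} is a right transversal of H_i in G *)
Definition right_transversals (t : forall i : 'I_s, 'I_(m i) -> G) : Prop :=
  forall (i : 'I_s) (g : G), exists! j : 'I_(m i), rcoset_of (H i) (t i j) g.

(* The alphabet is the disjoint union of the index sets 'I_(m i).  Since
   (i, j)^g = (i, j') iff t_ij g lies in H_i t_ij', the state-closed recursion
   prescribes the letter permutation and all states of the image of each g,
   and hence determines phi. *)
Definition data_representation (t : forall i : 'I_s, 'I_(m i) -> G)
    (phi : G -> tree_aut {i : 'I_s & 'I_(m i)}) : Prop :=
  forall (g : G) (i : 'I_s) (j j' : 'I_(m i)),
    rcoset_of (H i) (t i j') (t i j * g) ->
    letter (phi g) (Tagged _ j) = Tagged _ j' /\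
    state (phi g) (Tagged _ j) = phi (f i (t i j * g * (t i j')^-1)).

Definition self_similar_wrt : Prop :=
  exists (t : forall i : 'I_s, 'I_(m i) -> G)
         (phi : {multiplicative G -> tree_aut {i : 'I_s & 'I_(m i)}}),
    [/\ right_transversals t, data_representation t phi & injective phi].

Fixpoint level_subgroup (i : 'I_s) (j : nat) : set G :=
  if j is j'.+1 then [set h | H i h /\ level_subgroup i j' (f i h)] else setT.

Definition parabolic (i : 'I_s) : set G := \bigcap_j level_subgroup i j.

End Data.

Record right_action (A : groupType) (U : Type) := RightAction {
  ra_act :> U -> A -> U;
  ra_act1 : forall u, ra_act u 1 = u;
  ra_actM : forall u a b, ra_act u (a * b) = ra_act (ra_act u a) b
}.

Section CosetAction.
Variables (G : groupType) (s : nat) (P : 'I_s -> set G).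

Definition coset_tuple := forall i : 'I_s, set_type (rcosets_of (P i)).

Lemma rcosets_translate (K : set G) (X : set_type (rcosets_of K)) (g : G) :
  [set x * g | x in val X] \in rcosets_of K.
Proof.
case: X => X /= /[!inE] -[x _ <-]; exists (x * g) => //.
apply/seteqP; split=> z /=.
  by move=> [h Kh <-]; exists (h * x); [exists h | rewrite mulgA].
by move=> [_ [h Kh <-] <-]; exists h; rewrite ?mulgA.
Qed.

Definition coset_translate (K : set G) (X : set_type (rcosets_of K)) (g : G) :
  set_type (rcosets_of K) := SigSub (rcosets_translate X g).

Definition coset_tuple_act (u : coset_tuple) (g : {ffun 'I_s -> G}) :
  coset_tuple := fun i => coset_translate (u i) (g i).

Fact coset_tuple_act1 u : coset_tuple_act u 1 = u.
Proof.
apply: functional_extensionality_dep => i; apply: val_inj => /=.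
rewrite ffunE; move: (val (u i)) => X; apply/seteqP; split=> x /=.
  by move=> [y Xy <-]; rewrite mulg1.
by move=> Xx; exists x; rewrite ?mulg1.
Qed.

Fact coset_tuple_actM u a b :
  coset_tuple_act u (a * b) = coset_tuple_act (coset_tuple_act u a) b.
Proof.
apply: functional_extensionality_dep => i; apply: val_inj => /=.
rewrite ffunE; move: (val (u i)) => X; apply/seteqP; split=> x /=.
  move=> [y Xy <-]; exists (y * a i); last by rewrite mulgA.
  by exists y.
by move=> [_ [y Xy <-] <-]; exists y; rewrite ?mulgA.
Qed.

Definition coset_action : right_action {ffun 'I_s -> G} coset_tuple :=
  RightAction coset_tuple_act1 coset_tuple_actM.

End CosetAction.

Section FinitelySupported.
Variables (U : Type) (B : groupType).

Record fsupp := FSupp {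
  fs_fun :> U -> B;
  fs_finite : finite_set [set u | fs_fun u <> 1]
}.

Lemma fsuppP (x y : fsupp) : x =1 y -> x = y.
Proof.
case: x y => [x p] [y q] /= /funext exy.
by case: _ / exy q => q; congr FSupp; exact: Prop_irrelevance.
Qed.

HB.instance Definition _ := gen_eqMixin fsupp.
HB.instance Definition _ := gen_choiceMixin fsupp.

Definition fs_one : fsupp.
Proof.
exists (fun=> 1); apply: (sub_finite_set _ (finite_set0 _)).
by move=> u /=.
Defined.

Definition fs_mul (x y : fsupp) : fsupp.
Proof.
exists (fun u => x u * y u).
have fxy : finite_set ([set u | x u <> 1] `|` [set u | y u <> 1]).
  by rewrite finite_setU; split; exact: fs_finite.
apply: sub_finite_set fxy => u /= xy1.
by have [x1|] := pselect (x u = 1); [right|left] => // y1; rewrite x1 y1 mulg1 in xy1.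
Defined.

Definition fs_inv (x : fsupp) : fsupp.
Proof.
exists (fun u => (x u)^-1); apply: sub_finite_set (fs_finite x) => u /= xV x1.
by rewrite x1 invg1 in xV.
Defined.

Fact fs_mulA : associative fs_mul.
Proof. by move=> x y z; apply: fsuppP => u /=; rewrite mulgA. Qed.
Fact fs_mul1g : left_id fs_one fs_mul.
Proof. by move=> x; apply: fsuppP => u /=; rewrite mul1g. Qed.
Fact fs_mulg1 : right_id fs_one fs_mul.
Proof. by move=> x; apply: fsuppP => u /=; rewrite mulg1. Qed.
Fact fs_mulVg : left_inverse fs_one fs_inv fs_mul.
Proof. by move=> x; apply: fsuppP => u /=; rewrite mulVg. Qed.
Fact fs_mulgV : right_inverse fs_one fs_inv fs_mul.
Proof. by move=> x; apply: fsuppP => u /=; rewrite mulgV. Qed.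

HB.instance Definition _ := isGroup.Build fsupp
  fs_mulA fs_mul1g fs_mulg1 fs_mulVg fs_mulgV.

End FinitelySupported.

(* The underlying set of the semidirect product of B^(U) by A; the pair (a, x)
   is the product a x.  The action [to] only matters for the group law below. *)
Record pwreath (B A : groupType) (U : Type) (to : right_action A U) :=
  PWreath { pw_top : A; pw_base : fsupp U B }.

Section PermutationalWreathProduct.
Variables (B A : groupType) (U : Type) (to : right_action A U).

(* the right action of A on B^(U): the value at u is moved to u a *)
Definition fs_translate (x : fsupp U B) (a : A) : fsupp U B.
Proof.
exists (fun u => x (to u a^-1)).
apply: (@sub_finite_set _ _ ((to^~ a) @` [set u | x u <> 1])).
  by move=> u /= xu; exists (to u a^-1) => //; rewrite -ra_actM mulVg ra_act1.
exact/finite_image/fs_finite.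
Defined.

Local Notation W := (pwreath B to).

HB.instance Definition _ := gen_eqMixin W.
HB.instance Definition _ := gen_choiceMixin W.

(* [fs_translate x a] is the conjugate a^-1 x a *)
Definition pw_one : W := PWreath to 1 1.
Definition pw_mul (p q : W) : W :=
  PWreath to (pw_top p * pw_top q)
             (fs_translate (pw_base p) (pw_top q) * pw_base q).
Definition pw_inv (p : W) : W :=
  PWreath to (pw_top p)^-1 (fs_translate (pw_base p)^-1 (pw_top p)^-1).

Fact fs_translate1 x : fs_translate x 1 = x.
Proof. by apply: fsuppP => u /=; rewrite invg1 ra_act1. Qed.
Fact fs_translateM x a b :
  fs_translate x (a * b) = fs_translate (fs_translate x a) b.
Proof. by apply: fsuppP => u /=; rewrite invgM ra_actM. Qed.
Fact fs_translate_mul x y a :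
  fs_translate (x * y) a = fs_translate x a * fs_translate y a.
Proof. exact: fsuppP. Qed.
Fact fs_translate_one a : fs_translate 1 a = 1.
Proof. exact: fsuppP. Qed.

Fact pw_mulA : associative pw_mul.
Proof.
move=> [a x] [b y] [c z]; rewrite /pw_mul /= mulgA.
by rewrite fs_translate_mul -fs_translateM mulgA.
Qed.
Fact pw_mul1g : left_id pw_one pw_mul.
Proof. by case=> a x; rewrite /pw_mul /= fs_translate_one !mul1g. Qed.
Fact pw_mulg1 : right_id pw_one pw_mul.
Proof. by case=> a x; rewrite /pw_mul /= fs_translate1 !mulg1. Qed.
Fact pw_mulVg : left_inverse pw_one pw_inv pw_mul.
Proof.
case=> a x; rewrite /pw_mul /= -fs_translateM !mulVg fs_translate1.
by rewrite mulVg.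
Qed.
Fact pw_mulgV : right_inverse pw_one pw_inv pw_mul.
Proof.
by case=> a x; rewrite /pw_mul /= -fs_translate_mul !mulgV fs_translate_one.
Qed.

HB.instance Definition _ := isGroup.Build W
  pw_mulA pw_mul1g pw_mulg1 pw_mulVg pw_mulgV.

End PermutationalWreathProduct.

(* B^((G_omega_1 \ G) x ... x (G_omega_s \ G)) ><| G^s *)
Definition parabolic_wreath (B G : groupType) (s : nat) (m : 'I_s -> nat)
    (D : Gdata G m) : groupType :=
  pwreath B (coset_action (parabolic D)).

(* Main.v *)
Require Import Defs.
From HB Require Import structures.
From mathcomp Require Import all_boot all_order all_fingroup.
From mathcomp Require Import boolp classical_sets cardinality fsbigop.

Set Implicit Arguments.
Unset Strict Implicit.
Unset Printing Implicit Defensive.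

Local Open Scope classical_set_scope.
Local Open Scope group_scope.

(** Self-similarity with a prescribed orbit type amounts to exhibiting finitely
    many pairs (H_i, f_i) of a subgroup and a partial endomorphism whose core is
    trivial ([self_similar_of_trivial_core]).  Conversely, since the given
    representation of G is faithful, the core of the given data is trivial
    ([self_similar_wrt_trivial_core]).

    Write A = G^s, U for the product of the coset spaces, u0 for the tuple of
    the trivial cosets, and W for the wreath product.  Let H and f be the
    product of the H_i and of the f_i, so that the stabiliser of u0 in A is the
    intersection of the domains of all the iterates of f.  Two consequences:
    - f preserves and reflects fixing u0, so u0 h |-> u0 f(h) is a well-defined
      injection of u0 H into U, and functions on U can be pushed along it;
    - a point u <> u0 cannot be pushed forever: at some stage it leaves u0 H.

    The data for W consists of two pairs.  The first one has as domain the pairs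
    (a, x) with a in H and the product of all the values of x equal to 1, and
    maps (a, x) to (f(a), push of x).  As B is abelian, that product is a
    translation-invariant morphism onto B, so the index is |B| m_1 ... m_s.  The
    second one has domain W, hence an orbit of size 1, and maps (a, x) to
    (a shifted cyclically, 1).

    Let K be normal, contained in the first domain and stable under both maps.
    Using the shift, every coordinate of a top component of K occurs at every
    position, so these coordinates form a normal subset of G which lies in every
    H_i and is stable under every f_i: they are trivial.  Hence K lies in the
    base group.  Push an element x of K repeatedly: its value at u0 does not
    change while all the other points of its finite support disappear, so in the
    end the product of its values is x(u0).  As K stays in the domain, x(u0) = 1;
    by transitivity of A on U and normality of K, x = 1 ([wreath_base_core],
    [pw_trivial_core]). *)

(** * Subgroups, transversals and cores *)

Section PartialMorphism.
Variables (G : groupType) (H : set G) (f : G -> G).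
Hypothesis HG : subgroup H.
Hypothesis fM : forall x y, H x -> H y -> f (x * y) = f x * f y.

Lemma subgroup1 : H 1. Proof. by case: HG. Qed.

Lemma subgroupV x : H x -> H x^-1.
Proof. by rewrite -[x^-1]mul1g; apply: HG.2; exact: subgroup1. Qed.

Lemma subgroupM x y : H x -> H y -> H (x * y).
Proof.
by move=> Hx Hy; rewrite -[y]invgK; apply: HG.2 => //; exact: subgroupV.
Qed.

Lemma partial_morph1 : f 1 = 1.
Proof.
by apply: (mulgI (f 1)); rewrite mulg1 -fM ?mulg1 //; exact: subgroup1.
Qed.

Lemma partial_morphV x : H x -> f x^-1 = (f x)^-1.
Proof.
move=> Hx; apply: (mulgI (f x)).
by rewrite -fM ?mulgV ?partial_morph1 //; exact: subgroupV.
Qed.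

End PartialMorphism.

Definition transversal_of (G : groupType) (H : set G) (Y : Type) (t : Y -> G) :=
  forall g, exists! y, H (g * (t y)^-1).

Definition conj_invariant (G : groupType) (K : set G) :=
  forall g x, K x -> K (g * x * g^-1).

(** Quantifying over all conjugation-invariant sets instead of normal subgroups
    gives an equivalent condition when each [f i] is a morphism on a subgroup
    [H i], since the subgroup generated by such a set inherits its closure
    properties; it spares proving closure under products. *)
Definition trivial_core (G : groupType) (I : Type) (H : I -> set G)
    (f : I -> G -> G) :=
  forall K : set G, conj_invariant K ->
    (forall i x, K x -> H i x /\ K (f i x)) ->
  forall x, K x -> x = 1.

(** * From a data with trivial core to a state-closed group *)

Section Representation.
Variables (G : groupType) (I : finType) (Y : I -> finType).
Variables (H : I -> set G) (f : I -> G -> G) (t : forall i, Y i -> G).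
Arguments t : clear implicits.
Hypothesis HG : forall i, subgroup (H i).
Hypothesis fM : forall i x y, H i x -> H i y -> f i (x * y) = f i x * f i y.
Hypothesis tH : forall i, transversal_of (H i) (t i).
Arguments tH : clear implicits.

Local Notation X := {i : I & Y i}.

Definition coset_index i (g : G) : Y i := projT1 (cid (tH i g)).

Lemma coset_indexP i g : H i (g * (t i (coset_index i g))^-1).
Proof. by have [] := projT2 (cid (tH i g)). Qed.

Lemma coset_index_eq i g y : H i (g * (t i y)^-1) -> coset_index i g = y.
Proof. by have [_] := projT2 (cid (tH i g)); apply. Qed.

Lemma coset_indexM i h g : H i h -> coset_index i (h * g) = coset_index i g.
Proof.
move=> Hh; apply: coset_index_eq; rewrite -mulgA.
by apply: (subgroupM (HG i) Hh); exact: coset_indexP.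
Qed.

Definition letter_act (x : X) (g : G) : X :=
  Tagged Y (coset_index (tag x) (t _ (tagged x) * g)).

(** The unique element [h] of [H i] with [t y * g = h * t y'], where [y'] is the
    image of the letter [y] of the [i]-th orbit; its image under [f i] is the
    state of [g] at [y]. *)
Definition letter_cocycle (x : X) (g : G) : G :=
  t _ (tagged x) * g * (t _ (tagged (letter_act x g)))^-1.

Definition letter_state (x : X) (g : G) : G := f (tag x) (letter_cocycle x g).

Lemma letter_cocycle_in x g : H (tag x) (letter_cocycle x g).
Proof. exact: coset_indexP. Qed.

Lemma letter_act1 x : letter_act x 1 = x.
Proof.
case: x => i y; congr existT; apply: coset_index_eq.
by rewrite /= mulg1 mulgV; exact: subgroup1.
Qed.

Lemma letter_actM x g h : letter_act x (g * h) = letter_act (letter_act x g) h.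
Proof.
case: x => i y; congr existT => /=.
rewrite -[RHS](coset_indexM _ (coset_indexP i (t i y * g))).
by rewrite !mulgA mulgVK.
Qed.

Lemma letter_state1 x : letter_state x 1 = 1.
Proof.
rewrite /letter_state /letter_cocycle letter_act1 mulg1 mulgV.
exact: partial_morph1 (HG _) (@fM _).
Qed.

Lemma letter_stateM x g h :
  letter_state x (g * h) = letter_state x g * letter_state (letter_act x g) h.
Proof.
rewrite /letter_state -fM; last first.
- exact: (letter_cocycle_in (letter_act x g)).
- exact: letter_cocycle_in.
congr f; rewrite /letter_cocycle letter_actM.
by rewrite !mulgA mulgVK.
Qed.

(** The letter action and the states satisfy [(x u)^g = x^g u^(g_x)], and the
    cocycle identity [letter_stateM] makes this recursion an action on words. *)
Fixpoint word_act (g : G) (u : seq X) : seq X :=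
  if u is x :: v then letter_act x g :: word_act (letter_state x g) v else [::].

Lemma word_act1 u : word_act 1 u = u.
Proof. by elim: u => //= x u IHu; rewrite letter_act1 letter_state1 IHu. Qed.

Lemma word_actM g h u : word_act (g * h) u = word_act h (word_act g u).
Proof.
by elim: u g h => //= x u IHu g h; rewrite letter_actM letter_stateM IHu.
Qed.

Lemma word_actK g : cancel (word_act g) (word_act g^-1).
Proof. by move=> u; rewrite -word_actM mulgV word_act1. Qed.

Lemma word_actVK g : cancel (word_act g^-1) (word_act g).
Proof. by move=> u; rewrite -word_actM mulVg word_act1. Qed.

Lemma word_act_rcons g u x :
  exists z, word_act g (rcons u x) = rcons (word_act g u) z.
Proof.
elim: u g => [|y u IHu] g /=; first by exists (letter_act x g).
by have [z ->] := IHu (letter_state y g); exists z.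
Qed.

Lemma word_act_edge g u v :
  tree_edge u v -> tree_edge (word_act g u) (word_act g v).
Proof.
case=> -[x ->].
  by have [z ->] := word_act_rcons g u x; left; exists z.
by have [z ->] := word_act_rcons g v x; right; exists z.
Qed.

Definition data_aut (g : G) : tree_aut X.
Proof.
exists (word_act g) => //.
  by exists (word_act g^-1); [exact: word_actK|exact: word_actVK].
move=> u v; split; last exact: word_act_edge.
by move=> /(word_act_edge g^-1); rewrite !word_actK.
Defined.

Lemma data_autM : {morph data_aut : g h / g * h}.
Proof. by move=> g h; apply: tree_autP => u; exact: word_actM. Qed.

HB.instance Definition _ :=
  isMultiplicative.Build G (tree_aut X) data_aut data_autM.

Lemma data_aut1 : data_aut 1 = 1.
Proof. by apply: tree_autP; exact: word_act1. Qed.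

Lemma state_data_aut g x : state (data_aut g) x = data_aut (letter_state x g).
Proof. exact: tree_autP. Qed.

(** The kernel is a normal subgroup which fixes every letter, hence lies in
    every [H i], and which contains all the states of its elements, hence is
    stable under every [f i]: it is contained in the core. *)
Lemma data_aut_inj : trivial_core H f -> injective data_aut.
Proof.
move=> core g h egh; apply: (mulIg h^-1); rewrite mulgV.
pose K := [set k | data_aut k = 1].
have K1 k : K k -> forall x, letter_act x k = x /\ K (letter_state x k).
  move=> Kk x; split; last first.
    by rewrite /K /= -state_data_aut Kk; exact: tree_autP.
  by have /(congr1 (fun a : tree_aut X => a [:: x])) [] := Kk.
have Kconj : conj_invariant K.
  move=> a k /= Kk; rewrite /K /= !data_autM Kk mulg1 -data_autM mulgV.
  exact: data_aut1.
apply: (core K) => // [i k Kk|]; last first.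
  by rewrite /K /= data_autM egh -data_autM mulgV data_aut1.
(* conjugating by a coset representative of [1] makes [k] a state cocycle *)
pose y := coset_index i 1; pose a := t i y.
have Kk' : K (a^-1 * k * a) by rewrite -{2}[a]invgK; exact: Kconj.
have [fixy] := K1 _ Kk' (Tagged Y y).
have := letter_cocycle_in (Tagged Y y) (a^-1 * k * a).
by rewrite /letter_state /letter_cocycle fixy /= -/a !mulgA mulgV mul1g mulgK.
Qed.

Lemma letter_orbit_data x :
  letter_orbit (range data_aut) x = [set z | tag z == tag x]%SET.
Proof.
apply/setP => z; rewrite !finset.inE; apply/asboolP/eqP.
  by move=> [_ [g _ <-] <-].
case: x z => i y [j z] /= eij; case: _ / eij y => y.
exists (data_aut ((t _ y)^-1 * t _ z)); first by exists ((t _ y)^-1 * t _ z).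
rewrite /letter /= /letter_act /= mulgA mulgV mul1g; congr existT.
by apply: coset_index_eq; rewrite mulgV; exact: subgroup1.
Qed.

Lemma perm_letter_orbits_data :
  perm_eq [seq #|o| | o : {set X} in letter_orbits (range data_aut)]
          [seq #|Y i| | i : I].
Proof.
pose block i : {set X} := [set z | tag z == i]%SET.
have -> : letter_orbits (range data_aut) = [set block i | i in I]%SET.
  apply/setP => o; apply/imsetP/imsetP => -[x _ ->].
    by exists (tag x) => //; rewrite letter_orbit_data.
  by exists (Tagged Y (coset_index x 1)) => //; rewrite letter_orbit_data.
have block_inj : injective block.
  move=> i j /setP/(_ (Tagged Y (coset_index i 1))).
  by rewrite !finset.inE /= eqxx => /esym/eqP.
have -> : [seq #|Y i| | i : I] = [seq #|o| | o : {set X} <- [seq block i | i : I]].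
  rewrite -map_comp; apply: eq_map => i /=.
  rewrite -(card_imset predT (f := fun y : Y i => Tagged Y y)); last first.
    by move=> y z /eqP; rewrite eq_Tagged => /eqP.
  apply: eq_card => -[j y]; rewrite !finset.inE /=; apply/imsetP/eqP.
    by move=> [z _ /eqP]; rewrite -tag_eqE => /andP[/eqP].
  by move=> eji; case: _ / eji; exists y.
apply: perm_map; apply: uniq_perm.
- exact: enum_uniq.
- by rewrite map_inj_uniq ?enum_uniq.
move=> o; rewrite mem_enum.
by apply/imsetP/mapP => -[i]; exists i; rewrite ?mem_enum.
Qed.

(** The converse half of the correspondence between data and state-closed
    groups, with the [i]-th orbit indexed by the transversal of [H i]. *)
Theorem self_similar_of_trivial_core (m : seq nat) :
  trivial_core H f -> perm_eq [seq #|Y i| | i : I] m ->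
  self_similar_of_orbit_type G m.
Proof.
move=> core mY; exists X, (range data_aut); split.
- by rewrite card_tagged !sumnE (perm_big _ mY).
- split; first by exists 1; [|exact: data_aut1].
  move=> _ _ [g _ <-] [h _ <-]; exists (g * h^-1) => //.
  by apply: (mulIg (data_aut h)); rewrite -data_autM !mulgKV.
- by move=> _ x [g _ <-]; rewrite state_data_aut; exists (letter_state x g).
- exact: perm_trans perm_letter_orbits_data mY.
- by exists data_aut => //; exact: data_aut_inj.
Qed.

End Representation.

Section CoreOfRepresentation.
Variables (G : groupType) (s : nat) (m : 'I_s -> nat) (D : Gdata G m).

(** Elements of an invariant subset of the core fix every letter, and their
    states are again such elements; so they act trivially on all words. *)
Lemma self_similar_wrt_trivial_core :
  self_similar_wrt D -> trivial_core (gd_H D) (gd_f D).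
Proof.
move=> [t [phi [tH phiP phi_inj]]] K Kconj KH x Kx; apply: phi_inj.
have fix_words : forall u k, K k -> phi k u = u.
  elim=> [|[i j] u IHu] k Kk; first by rewrite ta_root.
  have [Hk Kf] := KH i _ (Kconj (t i j) _ Kk).
  have [|e1 e2] := phiP k i j j.
    by exists (t i j * k * (t i j)^-1); rewrite ?mulgKV.
  by rewrite stateE e1 e2 IHu.
apply: tree_autP => u; rewrite fix_words //.
have /mulgI -> : phi x * phi 1 = phi x * 1 by rewrite -gmulfM !mulg1.
by [].
Qed.

End CoreOfRepresentation.

(** * Products of finitely supported functions *)

Section Total.
Variables (U : Type) (B : groupType).
Implicit Types x y : fsupp U B.

(** The factors are taken in an arbitrary order, so this is canonical only under
    the hypothesis [mulBC] below. *)
Definition total x : B := \big[mulg/1]_(u \in [set: {classic U}]) x u.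

Definition fs_delta (u0 : U) (b : B) : fsupp U B.
Proof.
exists (fun u => if `[< u = u0 >] then b else 1).
apply: (sub_finite_set _ (finite_set1 u0)) => u /=.
by case: asboolP.
Defined.

Hypothesis mulBC : commutative (@mulg B).

Let mulB : Monoid.com_law (1 : B) :=
  HB.pack (@mulg B) (Monoid.isComLaw.Build B 1 mulg (@mulgA B) mulBC (@mul1g B)).

Lemma total_supported_at u0 x : (forall u, u <> u0 -> x u = 1) -> total x = x u0.
Proof.
move=> xu0; pose F (u : {classic U}) : B := x u.
rewrite -[RHS](@fsbig_set1 _ _ mulB {classic U} u0 F).
by apply/esym/fsbig_widen => // u [_ /=]; exact: xu0.
Qed.

Lemma total_delta u0 b : total (fs_delta u0 b) = b.
Proof.
rewrite (@total_supported_at u0) /= ?asboolT //.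
by move=> u uu0; rewrite asboolF.
Qed.

Lemma totalM x y : total (x * y) = total x * total y.
Proof.
pose S : set {classic U} := [set u | x u <> 1] `|` [set u | y u <> 1].
have Sfin : finite_set S by rewrite finite_setU; split; exact: fs_finite.
have totalS (z : fsupp U B) : (forall u, x u = 1 -> y u = 1 -> z u = 1) ->
    total z = \big[mulB/1]_(u \in S) z u.
  move=> zS; apply/esym/fsbig_widen => // u [_ /= nS].
  by apply: zS; apply: contrapT => H; apply: nS; [left|right].
rewrite !totalS // => [|u xu yu]; last by rewrite /= xu yu mulg1.
exact: (fsbig_split mulB).
Qed.

Lemma total1 : total 1 = 1.
Proof. by apply: (mulgI (total 1)); rewrite -totalM !mulg1. Qed.

Lemma totalV x : total x^-1 = (total x)^-1.
Proof. by apply: (mulgI (total x)); rewrite -totalM !mulgV total1. Qed.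

End Total.

Lemma total_translate (B A : groupType) (U : Type) (to : right_action A U) :
  commutative (@mulg B) ->
  forall (x : fsupp U B) a, total (fs_translate to x a) = total x.
Proof.
move=> mulBC x a.
pose mulB : Monoid.com_law (1 : B) :=
  HB.pack (@mulg B) (Monoid.isComLaw.Build B 1 mulg (@mulgA B) mulBC (@mul1g B)).
apply/esym; apply: (@reindex_fsbigT _ _ mulB {classic U} {classic U} (to^~ a^-1)).
by exists (to^~ a) => u; rewrite -ra_actM ?mulVg ?mulgV ra_act1.
Qed.

(** * The wreath product over a self-similar transitive action *)

(** [A] acts on [U] transitively from [u0], and [f] is a morphism from the subgroup
    [H] to [A] such that the stabiliser of [u0] is the intersection of the domains
    of the iterates of [f]. *)
Section WreathData.
Variables (B A : groupType) (U : Type) (to : right_action A U) (u0 : U).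
Variables (H : set A) (f : A -> A).
Hypothesis HA : subgroup H.
Hypothesis fM : forall a b, H a -> H b -> f (a * b) = f a * f b.

Fixpoint iter_domain (n : nat) : set A :=
  if n is n'.+1 then [set h | H h /\ iter_domain n' (f h)] else setT.

Lemma iter_domain_subgroup n : subgroup (iter_domain n).
Proof.
elim: n => [|n IHn] //; split=> /=.
  by rewrite (partial_morph1 HA fM); split; exact: subgroup1.
move=> a b [Ha fa] [Hb fb]; split; first exact: HA.2.
rewrite fM ?(partial_morphV HA fM) //; first exact: IHn.2.
exact: subgroupV.
Qed.

Lemma iter_domainS n a : iter_domain n.+1 a -> iter_domain n a.
Proof. by elim: n a => [|n IHn] a //= [Ha /IHn]. Qed.

Lemma iter_domain_leq n n' a : n <= n' -> iter_domain n' a -> iter_domain n a.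
Proof.
move=> /subnK <-; elim: (n' - n) => [|k IHk] //.
by rewrite addSn => /iter_domainS.
Qed.

Hypothesis mulBC : commutative (@mulg B).
Hypothesis to_trans : forall u, exists a, to u0 a = u.
Hypothesis stabE : forall a, to u0 a = u0 <-> forall n, iter_domain n a.

Lemma act_eq a b : to u0 a = to u0 b <-> to u0 (a * b^-1) = u0.
Proof.
split=> [e|e]; first by rewrite ra_actM e -ra_actM mulgV ra_act1.
by rewrite -{2}e -ra_actM mulgVK.
Qed.

Lemma stab_domain a : to u0 a = u0 -> H a.
Proof. by move=> /stabE /(_ 1%N) []. Qed.

(** [h] lies in the domain of the [n.+1]-st iterate of [f] exactly when [f h] lies
    in that of the [n]-th one, so both sides unfold to the same condition. *)
Lemma stab_f h : H h -> to u0 (f h) = u0 <-> to u0 h = u0.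
Proof.
move=> Hh; split=> /stabE e; apply/stabE => n; last by have [] := e n.+1.
by case: n.
Qed.

Lemma act_f_eq g h : H g -> H h ->
  to u0 (f g) = to u0 (f h) <-> to u0 g = to u0 h.
Proof.
move=> Hg Hh; rewrite act_eq -(partial_morphV HA fM) //.
rewrite -fM //; last exact: subgroupV.
by rewrite stab_f -?act_eq //; exact: HA.2.
Qed.

(** By [act_f_eq] the morphism [f] induces an injection [u0 h |-> u0 (f h)] of
    the [H]-orbit of [u0] into [U]; this is its inverse on [f_orbit], and
    irrelevant elsewhere. *)
Definition pull (v : U) : U := to u0 (xget 1 [set h | H h /\ to u0 (f h) = v]).

Definition f_orbit : set U := [set to u0 (f h) | h in H].

Lemma pullE h : H h -> pull (to u0 (f h)) = to u0 h.
Proof.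
move=> Hh; rewrite /pull; case: xgetP => [g _ [Hg]|/(_ h)/not_andP[]//].
by move=> /act_f_eq ->.
Qed.

(** Transports [x] along that injection: the values outside the [H]-orbit of [u0]
    are forgotten, and the new values outside [f_orbit] are [1]. *)
Definition push (x : fsupp U B) : fsupp U B.
Proof.
exists (fun v => if `[< f_orbit v >] then x (pull v) else 1).
set S := [set v | _]; have SP v : S v -> f_orbit v /\ x (pull v) <> 1.
  by rewrite /S /=; case: asboolP.
have pull_inj : {in S &, injective pull}.
  move=> u v /set_mem/SP [[h Hh <-] _] /set_mem/SP [[g Hg <-] _].
  by rewrite !pullE // => /act_f_eq ->.
rewrite -(eq_finite_set (inj_card_eq pull_inj)).
by apply: sub_finite_set (fs_finite x) => _ [v /SP[_ xv] <-].
Defined.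

Lemma pushE x h : H h -> push x (to u0 (f h)) = x (to u0 h).
Proof. by move=> Hh; rewrite /= asboolT ?pullE //; exists h. Qed.

Lemma push_out x v : ~ f_orbit v -> push x v = 1.
Proof. by move=> nv; rewrite /= asboolF. Qed.

Lemma pushM x y : push (x * y) = push x * push y.
Proof. by apply: fsuppP => v /=; case: asboolP => // _; rewrite mulg1. Qed.

(** Translation by [a] in [H] preserves the [H]-orbit of [u0] and its complement,
    and corresponds to translation by [f a] on [f_orbit]. *)
Lemma push_translate x a : H a ->
  push (fs_translate to x a) = fs_translate to (push x) (f a).
Proof.
move=> Ha; apply: fsuppP => v.
have HaV := subgroupV HA Ha.
have fV := partial_morphV HA fM Ha.
have [[h Hh <-]|nv] := pselect (f_orbit v).
  rewrite pushE // [RHS]/= -/(push x _) -ra_actM -fV -fM //.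
  rewrite -[RHS]/(push x _) pushE /= ?ra_actM //; exact: subgroupM.
rewrite push_out // -[RHS]/(push x _) push_out // => -[h Hh e]; apply: nv.
exists (h * a); first exact: subgroupM.
by rewrite fM // ra_actM e -ra_actM mulVg ra_act1.
Qed.

Local Notation W := (pwreath B to).

(** The condition on the total multiplies the index of [H] by the order of [B];
    it is what excludes nontrivial functions supported at [u0] alone. *)
Definition wreath_domain : set W :=
  [set p | H (pw_top p) /\ total (pw_base p) = 1].

Definition wreath_morph (p : W) : W :=
  PWreath to (f (pw_top p)) (push (pw_base p)).

Definition total_base (p : W) : B := total (pw_base p).

(** The total is invariant under translation, so it extends to [W]. *)
Lemma total_baseM p q : total_base (p * q) = total_base p * total_base q.
Proof. by rewrite /total_base /= totalM // total_translate. Qed.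

Lemma total_baseV p : total_base p^-1 = (total_base p)^-1.
Proof. by rewrite /total_base /= total_translate // totalV. Qed.

Lemma wreath_domain_subgroup : subgroup wreath_domain.
Proof.
split; first by split; [exact: subgroup1|exact: total1].
move=> p q [Hp tp] [Hq tq]; split; first exact: HA.2.
by rewrite -/(total_base _) total_baseM total_baseV /total_base tp tq mulgV.
Qed.

Lemma wreath_morphM p q : wreath_domain p -> wreath_domain q ->
  wreath_morph (p * q) = wreath_morph p * wreath_morph q.
Proof.
by move=> [Hp _] [Hq _]; rewrite /wreath_morph /= fM // pushM push_translate.
Qed.

Lemma wreath_transversal (Y : Type) (t : Y -> A) : transversal_of H t ->
  transversal_of wreath_domain
    (fun by_ : B * Y => PWreath to (t by_.2) (fs_delta u0 by_.1)).
Proof.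
move=> tH p; have [y [Hy yP]] := tH (pw_top p).
have totE b z : total_base (p * (PWreath to (t z) (fs_delta u0 b))^-1) =
    total_base p * b^-1.
  by rewrite total_baseM total_baseV /total_base /= total_delta.
exists (total_base p, y); split.
  by split=> //; exact: etrans (totE _ _) (mulgV _).
move=> [b z] [/yP -> e]; congr pair; apply: (mulIg b^-1).
by rewrite mulgV -(totE _ z).
Qed.

(** [x] is separated at depth [n] if among the points of its support only [u0]
    can be reached by [iter_domain n]. *)
Definition separated (n : nat) (x : fsupp U B) :=
  forall a, x (to u0 a) <> 1 -> iter_domain n a -> to u0 a = u0.

(** Each point [u <> u0] of the support is [u0 c] with [c] outside the stabiliser,
    so it is out of reach from some depth on; the support being finite, the
    maximum of these depths works. *)
Lemma separated_ex x : exists n, separated n x.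
Proof.
have [s sE] : exists s : seq {classic U}, [set u | x u <> 1] = [set` s].
  by apply/(@finite_seqP {classic U}); exact: fs_finite.
suff gen (P : A -> Prop) : (forall a, P a -> (to u0 a : {classic U}) \in s) ->
    exists n, forall a, P a -> iter_domain n a -> to u0 a = u0.
  by apply: gen => a xa; have : [set` s] (to u0 a) by rewrite -sE.
elim: s P {sE} => [|u s IHs] P Ps; first by exists 0 => a /Ps.
have [|n nP] := IHs (fun a => P a /\ to u0 a <> u).
  by move=> a [/Ps]; rewrite in_cons => /predU1P[].
have [k kP] : exists k, forall a, to u0 a = u -> iter_domain k a -> to u0 a = u0.
  have [c cu] := to_trans u; have [e|] := pselect (to u0 c = u0).
    by exists 0 => a; rewrite -cu e.
  move=> ne; have /existsNP [k nk] : ~ forall n, iter_domain n c by move/stabE.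
  exists k => a e ka; exfalso; apply: nk.
  have /stabE/(_ k) ck : to u0 (c * a^-1) = u0 by apply/act_eq; rewrite cu e.
  by rewrite -[c](mulgVK a); apply: subgroupM ck ka; exact: iter_domain_subgroup.
exists (maxn n k) => a Pa da.
have [e|ne] := pselect (to u0 a = u).
  by apply: kP => //; apply: iter_domain_leq da; exact: leq_maxr.
by apply: nP => //; apply: iter_domain_leq da; exact: leq_maxl.
Qed.

Lemma separated_push n x : separated n.+1 x -> separated n (push x).
Proof.
move=> sep a; have [[h Hh e]|nv] := pselect (f_orbit (to u0 a)); last first.
  by rewrite push_out.
rewrite -e pushE // => xh na; apply/stab_f => //; apply: sep => //; split=> //.
have /stabE/(_ n) c : to u0 (f h * a^-1) = u0 by apply/act_eq.
by rewrite -[f h](mulgVK a); apply: subgroupM c na; exact: iter_domain_subgroup.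
Qed.

Lemma push_base x : push x u0 = x u0.
Proof.
have f1 := partial_morph1 HA fM.
by rewrite -[in LHS](ra_act1 to u0) -f1 pushE ?ra_act1 //; exact: subgroup1.
Qed.

(** Pushing does not change the value at [u0], and by separation it eventually
    empties the rest of the finite support; but then that value is the total,
    which is trivial on [wreath_domain].  Conjugation by the transitive group
    [A] brings every other point to [u0]. *)
Lemma wreath_base_core (K : set W) : conj_invariant K ->
  (forall p, K p -> wreath_domain p /\ K (wreath_morph p)) ->
  forall x, K (PWreath to 1 x) -> x = 1.
Proof.
move=> Kconj Kf.
have at0 n x : separated n x -> K (PWreath to 1 x) -> x u0 = 1.
  elim: n x => [|n IHn] x sep Kx; have [[_ totx] Kpx] := Kf _ Kx.
    rewrite -(total_supported_at mulBC (u0 := u0)) // => u uu0.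
    apply: contrapT => xu; have [a au] := to_trans u.
    by apply: uu0; rewrite -au sep ?au.
  rewrite -push_base; apply: IHn; first exact: separated_push.
  by move: Kpx; rewrite /wreath_morph /= (partial_morph1 HA fM).
move=> x Kx; apply: fsuppP => u; have [a <-] := to_trans u.
have := Kconj (PWreath to a 1) _ Kx.
have -> : PWreath to a 1 * PWreath to 1 x * (PWreath to a 1)^-1 =
          PWreath to 1 (fs_translate to x a^-1).
  congr PWreath => /=; first by rewrite mulg1 mulgV.
  by apply: fsuppP => v /=; rewrite mul1g invg1 mulg1.
have [n sep] := separated_ex (fs_translate to x a^-1).
by move=> /(at0 _ _ sep) /=; rewrite invgK.
Qed.

End WreathData.

(** * The coset action of the power of a self-similar group *)

Section ParabolicAction.
Variables (G : groupType) (s : nat) (m : 'I_s -> nat) (D : Gdata G m).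

Local Notation H := (gd_H D).
Local Notation f := (gd_f D).
Local Notation A := {ffun 'I_s -> G}.
Local Notation U := (coset_tuple (parabolic D)).
Local Notation to := (coset_action (parabolic D)).

Definition prod_domain : set A := [set a | forall i, H i (a i)].
Definition prod_morph (a : A) : A := [ffun i => f i (a i)].

Lemma prod_domain_subgroup : subgroup prod_domain.
Proof.
split=> [i|a b Ha Hb i].
  by rewrite ffunE; exact: subgroup1 (gd_subgroup D i).
by rewrite !ffunE; apply: (gd_subgroup D i).2.
Qed.

Lemma prod_morphM a b : prod_domain a -> prod_domain b ->
  prod_morph (a * b) = prod_morph a * prod_morph b.
Proof.
by move=> Ha Hb; apply/ffunP => i; rewrite !ffunE (gd_morph (Ha i) (Hb i)).
Qed.

Lemma prod_transversal (t : forall i : 'I_s, 'I_(m i) -> G) :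
  right_transversals D t ->
  transversal_of prod_domain
    (fun j : {dffun forall i : 'I_s, 'I_(m i)} => [ffun i => t i (j i)]).
Proof.
have rcosetE i h g : rcoset_of (H i) h g <-> H i (g * h^-1).
  split=> [[x Hx <-]|Hg]; first by rewrite mulgK.
  by exists (g * h^-1); rewrite ?mulgVK.
move=> tH a; pose j i := projT1 (cid (tH i (a i))).
have jP i := projT2 (cid (tH i (a i))).
exists (finfun j); split=> [i|k kP].
  by rewrite !ffunE; apply/rcosetE; have [] := jP i.
apply/ffunP => i; rewrite ffunE; have [_] := jP i; apply; apply/rcosetE.
by have := kP i; rewrite !ffunE.
Qed.

Lemma level_subgroupE i n : level_subgroup D i n = iter_domain (H i) (f i) n.
Proof. by elim: n => //= n ->. Qed.

Lemma iter_prod_domain n a :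
  iter_domain prod_domain prod_morph n a <-> forall i, level_subgroup D i n (a i).
Proof.
elim: n a => [|n IHn] a //=; split=> [[Ha /IHn fa] i|Ha].
  by split=> //; have := fa i; rewrite ffunE.
split=> [i|]; first by have [] := Ha i.
by apply/IHn => i; rewrite ffunE; have [] := Ha i.
Qed.

Lemma parabolic_subgroup i : subgroup (parabolic D i).
Proof.
have lS n : subgroup (level_subgroup D i n).
  rewrite level_subgroupE.
  exact: iter_domain_subgroup (gd_subgroup D i) (@gd_morph _ _ _ D i) n.
split=> [n _|x y Px Py n _]; first exact: subgroup1 (lS n).
by apply: (lS n).2; [exact: Px|exact: Py].
Qed.

Lemma coset_mem (K : set G) g : rcoset_of K g \in rcosets_of K.
Proof. by rewrite inE; exists g. Qed.

Definition coset_base : U := fun i => SigSub (coset_mem (parabolic D i) 1).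

Lemma coset_baseE a i : val (to coset_base a i) = rcoset_of (parabolic D i) (a i).
Proof.
apply/seteqP; split=> x /=.
  by move=> [_ [h Ph <-] <-]; exists h; rewrite ?mulg1.
by move=> [h Ph <-]; exists h => //; exists h; rewrite ?mulg1.
Qed.

Lemma coset_base_trans u : exists a, to coset_base a = u.
Proof.
have ex i : exists g, rcoset_of (parabolic D i) g = val (u i).
  by have /set_mem[g _ <-] := valP (u i); exists g.
have [a aP] := choice ex; exists [ffun i => a i].
apply: functional_extensionality_dep => i; apply: val_inj.
by rewrite coset_baseE ffunE.
Qed.

Lemma coset_base_stab a : to coset_base a = coset_base <->
  forall n, iter_domain prod_domain prod_morph n a.
Proof.
have -> : (forall n, iter_domain prod_domain prod_morph n a) <->
          forall i, parabolic D i (a i).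
  split=> [Pa i n _|Pa n]; first by have /iter_prod_domain := Pa n.
  by apply/iter_prod_domain => i; exact: Pa.
split=> [e i|Pa].
  have: rcoset_of (parabolic D i) (a i) (a i).
    exists 1; last by rewrite mul1g.
    exact: subgroup1 (parabolic_subgroup i).
  by rewrite -coset_baseE e => -[h Ph <-]; rewrite mulg1.
apply: functional_extensionality_dep => i; apply: val_inj.
rewrite coset_baseE; apply/seteqP; split=> x /= [h Ph <-].
  exists (h * a i); last by rewrite mulg1.
  exact (subgroupM (parabolic_subgroup i) Ph (Pa i)).
exists (h * (a i)^-1); last by rewrite mulg1 mulgVK.
exact: (parabolic_subgroup i).2.
Qed.

End ParabolicAction.

(** * The data of the wreath product *)

Section ParabolicWreath.
Variables (B : finGroupType) (G : groupType) (s : nat) (m : 'I_s -> nat).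
Variable D : Gdata G m.

Local Notation A := {ffun 'I_s -> G}.
Local Notation W := (parabolic_wreath B D).
Local Notation U := (coset_tuple (parabolic D)).
Local Notation to := (coset_action (parabolic D)).

(** The base is forgotten because the cyclic shift of [G^s] does not act on [U]:
    its factors are different coset spaces. *)
Definition shift_top (p : W) : W := PWreath to [ffun i => pw_top p (ordS i)] 1.

Lemma shift_topM p q : shift_top (p * q) = shift_top p * shift_top q.
Proof.
congr PWreath; first by apply/ffunP => i; rewrite !ffunE.
by apply: fsuppP => u; rewrite /= mulg1.
Qed.

Lemma iter_ordS_trans (i j : 'I_s) : exists n, iter n (@ordS s) i = j.
Proof.
exists (j + (s - i)); apply: val_inj.
have iterE n : val (iter n (@ordS s) i) = (i + n) %% s.
  elim: n => [|n IHn] /=; first by rewrite addn0 modn_small.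
  by rewrite IHn -addn1 modnDml addn1 addnS.
by rewrite iterE addnCA subnKC ?(ltnW (ltn_ord i)) // modnDr modn_small.
Qed.

(** [true] is the index of the large orbit, [false] that of the fixed letter. *)
Definition pw_domain (b : bool) : set W :=
  if b then wreath_domain (prod_domain D) else setT.

Definition pw_morph (b : bool) : W -> W :=
  if b then wreath_morph (prod_domain_subgroup D) (@prod_morphM _ _ _ D)
                         (@coset_base_stab _ _ _ D)
  else shift_top.

(** The shift makes every coordinate of a top component of [K] available at every
    position, so that these coordinates lie in the core of [D]; the base is then
    dealt with by [wreath_base_core]. *)
Lemma pw_trivial_core : commutative (@mulg B) ->
  trivial_core (gd_H D) (gd_f D) -> trivial_core pw_domain pw_morph.
Proof.
move=> mulBC coreD K Kconj KH.
have Ktrue p : K p -> pw_domain true p /\ K (pw_morph true p) by exact: (KH true).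
have Kfalse p : K p -> K (shift_top p) by move=> /(KH false)[].
have Kiter n p : K p -> forall i,
    exists2 q, K q & pw_top q i = pw_top p (iter n (@ordS s) i).
  elim: n p => [|n IHn] p Kp i; first by exists p.
  by have [q Kq e] := IHn _ (Kfalse _ Kp) i; exists q => //; rewrite e ffunE.
pose L := [set g | exists2 p, K p & exists i, pw_top p i = g].
have Lall g : L g -> forall j, exists2 p, K p & pw_top p j = g.
  move=> [p Kp [i <-]] j; have [n <-] := iter_ordS_trans j i.
  exact: Kiter.
have L1 : forall g, L g -> g = 1.
  apply: coreD => [c g [p Kp [i <-]]|i g /Lall/(_ i)[p Kp <-]].
    have Kq := Kconj (PWreath to [ffun=> c] 1) _ Kp.
    by eexists; [exact: Kq|exists i; rewrite !ffunE].
  have [[Hp _] Kfp] := Ktrue _ Kp.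
  by split; [exact: Hp|exists (pw_morph true p) => //; exists i; rewrite ffunE].
have top1 p : K p -> pw_top p = 1.
  move=> Kp; apply/ffunP => i; rewrite [RHS]ffunE.
  by apply: L1; exists p => //; exists i.
case=> a x Kp; have /= a1 := top1 _ Kp; rewrite a1 in Kp *.
suff -> : x = 1 by [].
exact: (wreath_base_core mulBC (@coset_base_trans _ _ _ D) Kconj Ktrue Kp).
Qed.

End ParabolicWreath.

Local Close Scope group_scope.
Local Close Scope classical_set_scope.

Theorem theoremE (B : finGroupType) (G : groupType) (s : nat) (m : 'I_s -> nat)
    (D : Gdata G m) :
  abelian [set: B] ->
  (forall i : 'I_s, 2 <= m i) ->
  self_similar_wrt D ->
  self_similar_of_orbit_type (parabolic_wreath B D)
    [:: #|B| * \prod_(i < s) m i; 1].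
Proof.
move=> abB _ simD; have [t [_ [tH _ _]]] := simD.
have mulBC : commutative (@mulg B).
  by move=> x y; apply: (centsP abB); rewrite finset.inE.
pose J := {dffun forall i : 'I_s, 'I_(m i)}.
pose Y (b : bool) : finType := if b then (B * J)%type : finType else unit.
pose T (b : bool) : Y b -> parabolic_wreath B D :=
  match b return Y b -> parabolic_wreath B D with
  | true => fun y : (B * J)%type =>
      PWreath (coset_action (parabolic D)) [ffun i => t i (y.2 i)]
              (fs_delta (coset_base D) y.1)
  | false => fun=> 1%g
  end.
apply: (@self_similar_of_trivial_core _ _ Y (@pw_domain B _ _ _ D)
  (@pw_morph B _ _ _ D) T).
- by case=> //; apply: wreath_domain_subgroup (prod_domain_subgroup D) _.
- case=> [p q Hp Hq|p q _ _]; last exact: shift_topM.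
  exact: wreath_morphM.
- case=> [|p]; first exact: wreath_transversal (prod_transversal tH).
  by exists tt; split=> // -[].
- exact/pw_trivial_core/self_similar_wrt_trivial_core.
have map_bool (F : bool -> nat) : [seq F b | b : bool] = [:: F true; F false].
  by rewrite /image_mem enumT unlock.
rewrite map_bool /= card_unit card_prod card_dep_ffun.
suff -> : foldr muln 1 [seq #|'I_(m i)| | i : 'I_s] = \prod_(i < s) m i by [].
by rewrite foldrE big_map big_enum; apply: eq_bigr => i _; rewrite card_ord.
Qed.
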